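(* Let $\mathcal{M}$ be an $r\times c$ grid graph, and consider the online facility assignment problem on $\mathcal{M}$ (facilities of equal capacity on vertices of $\mathcal{M}$, customers arriving online on vertices of $\mathcal{M}$). Then $\mathcal{R}(\text{Algorithm Optimal-Fill}) = O(r\times c)$.
   Context: An $r\times c$ grid graph has as vertices the grid points of an $r\times c$ grid and edges the unit grid segments between consecutive grid points; distances are shortest-path lengths. Online facility assignment problem: facilities $F=\{f_1,\dots,f_{|F|}\}$, each of capacity $l\ge1$, are located on vertices; customers $c_1,\dots,c_n$ ($n\le |F|l$) arrive one at a time at vertices, and each must be irrevocably assigned to a facility with positive remaining capacity before the next arrives (which decreases that capacity by one). The cost of assigning $c_i$ to $f_j$ is $d(c_i,f_j)$; the objective is the total cost. $\text{Cost\_OPT}(I)$ is the minimum possible total (offline) cost for input $I$. ALG is $c$-competitive if there is a constant $\alpha$ with $\text{Cost\_ALG}(I)\le c\cdot\text{Cost\_OPT}(I)+\alpha$ for all finite inputs $I$; $\mathcal{R}(\text{ALG})$ is the infimum of such $c$. Algorithm Optimal-Fill: when customer $c_i$ arrives, it computes an optimal (minimum total cost) assignment of $c_1,\dots,c_i$ to the facilities; with unit capacities, exactly one facility used by this optimal assignment is not yet used by the algorithm's assignments of $c_1,\dots,c_{i-1}$ (in general, one new unit of capacity), and the algorithm assigns $c_i$ to that facility.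
   Formalization: The constant in O(r×c) and the additive constant α may depend on the capacity l, since with arbitrary tie-breaking a bound uniform in l is false; α is otherwise fixed before the grid and the facilities. *)

(* Defs.v *)
(* MathComp, with MathComp-Analysis for the infimum over the reals. *)
From HB Require Import structures.
From mathcomp Require Import all_boot all_order all_algebra.
From mathcomp Require Import classical_sets reals ereal constructive_ereal.

Set Implicit Arguments.
Unset Strict Implicit.
Unset Printing Implicit Defensive.

Import Order.TTheory GRing.Theory Num.Theory.

(* If there is no path from [x] to [y] the value is [#|T|]; a shortest path has
   fewer than [#|T|] edges. *)
Definition graph_dist (T : finType) (e : rel T) (x y : T) : nat :=
  \big[minn/#|T|]_(n < #|T| |
     [exists p : n.-tuple T, path e x p && (last x p == y)]) n.

Definition gridpoint (r c : nat) : finType := ('I_r * 'I_c)%type.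

Definition consecutive (i j : nat) : bool := (i.+1 == j) || (j.+1 == i).

Definition grid_edge (r c : nat) : rel (gridpoint r c) := fun u v =>
  (u.1 == v.1) && consecutive u.2 v.2 || consecutive u.1 v.1 && (u.2 == v.2).

Definition grid_dist (r c : nat) : gridpoint r c -> gridpoint r c -> nat :=
  graph_dist (@grid_edge r c).

Section Assignment.

Variables r c : nat.
Local Notation V := (gridpoint r c).

(* Facilities occupy distinct vertices and are identified with them: [F] is the
   set of facilities.  An assignment of the customers [s] is the sequence [t]
   of facilities, [nth t i] serving [nth s i]. *)
Variables (F : {set V}) (l : nat).

Definition feasible (s t : seq V) : bool :=
  [&& size t == size s, all (mem F) t & [forall f in F, count_mem f t <= l]].

Definition cost (s t : seq V) : nat :=
  \sum_(p <- zip s t) grid_dist p.1 p.2.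

Definition optimal (s t : seq V) : Prop :=
  feasible s t /\ forall t', feasible s t' -> cost s t <= cost s t'.

(* Distances are at most [#|V|], so the default value of the minimum bounds
   every cost from above and matters only if there is no feasible assignment. *)
Definition opt_cost (s : seq V) : nat :=
  \big[minn/size s * #|V|]_(t : (size s).-tuple V | feasible s t) cost s t.

Definition valid_input (s : seq V) : bool := size s <= #|F| * l.

(* [alg (rcons s x)] is the facility to which an online algorithm irrevocably
   assigns the arriving customer [x], [s] being the customers seen before. *)
Definition run (alg : seq V -> V) (s : seq V) : seq V :=
  [seq alg (take i.+1 s) | i <- iota 0 (size s)].

Definition alg_cost (alg : seq V -> V) (s : seq V) : nat := cost s (run alg s).

(* [perm_eq] compares loads: the optimal assignment [t] of all the customers
   [rcons s x] uses, at every facility, the units of capacity already consumed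
   by the algorithm, plus one new unit, which is at the facility chosen for
   [x].  Ties between optimal assignments may be broken in any way. *)
Definition optimal_fill (alg : seq V -> V) : Prop :=
  forall (s : seq V) (x : V), valid_input (rcons s x) ->
  exists2 t, optimal (rcons s x) t
           & perm_eq t (rcons (run alg s) (alg (rcons s x))).

Local Open Scope ring_scope.

Definition competitive (R : realType) (alpha : R) (alg : seq V -> V) (rho : R)
    : Prop :=
  forall s, valid_input s ->
  (alg_cost alg s)%:R <= rho * (opt_cost s)%:R + alpha.

(* The additive constant [alpha] is a parameter, to be fixed before the grid and
   the facilities.  A given [F] and [l] admit only finitely many inputs (at most
   [#|F| * l] customers), so with an [alpha] depending on them every algorithm
   would be 0-competitive. *)
Definition competitive_ratio (R : realType) (alpha : R) (alg : seq V -> V)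
    : \bar R :=
  ereal_inf [set rho%:E | rho in
    [set rho : R | 0 <= rho /\ competitive alpha alg rho]]%classic.

End Assignment.

(* Main.v *)
(* At each step Optimal-Fill pays at most the sum of the two consecutive optimal
   costs.  Indeed, let [f] be the facility chosen for [x] and let
   [phi v = d(v, f)].  Summed over customers minus facilities, [phi] changes by
   [phi x - phi f = d(x, f)] when [x] and [f] are added; as [phi] is 1-Lipschitz,
   each of the two sums is bounded in absolute value by the cost of any
   assignment with these customers and loads, in particular by the optimum.
   Since optima increase along the input, the algorithm pays at most
   [2 n OPT], and [n <= l |F| <= l r c]. *)
Require Import Defs.
From HB Require Import structures.
From mathcomp Require Import all_boot all_order all_algebra.
From mathcomp Require Import classical_sets reals ereal constructive_ereal.
From mathcomp Require Import zify.

Import Order.TTheory GRing.Theory Num.Theory.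

Section GraphDistance.

Set Implicit Arguments.
Unset Strict Implicit.
Unset Printing Implicit Defensive.

Variables (T : finType) (e : rel T).

Lemma graph_dist_le_card x y : graph_dist e x y <= #|T|.
Proof.
rewrite /graph_dist; elim/big_ind: _ => // [m n|i _].
  by rewrite geq_min => ->.
exact: ltnW.
Qed.

Lemma graph_dist_le x y p :
  path e x p -> last x p = y -> graph_dist e x y <= size p.
Proof.
(* A walk with [#|T|] or more edges need not be shortened: the default value of the minimum already
   bounds the distance. *)
move=> xp pE; case: (ltnP (size p) #|T|) => [ltpT|]; last first.
  exact/leq_trans/graph_dist_le_card.
rewrite /graph_dist -minEnat -leEnat; apply: (bigmin_inf (Ordinal ltpT)) => //.
by apply/existsP; exists (in_tuple p); rewrite xp pE /=.
Qed.

Lemma graph_dist_attained x y : graph_dist e x y < #|T| ->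
  exists p, [/\ path e x p, last x p = y & size p = graph_dist e x y].
Proof.
rewrite /graph_dist; elim/big_ind: _ => [|m n IHm IHn|i].
- by rewrite ltnn.
- by case: (leqP m n) => _.
by move=> /existsP[p /andP[xp /eqP pE]] _; exists p; rewrite size_tuple.
Qed.

Lemma graph_dist_self x : graph_dist e x x = 0.
Proof. by apply/eqP; rewrite -leqn0 (@graph_dist_le x x [::]). Qed.

(** Concatenate shortest paths. If a distance on the right is the default [#|T|], it alone bounds
    the left side, so connectedness is not assumed. *)
Lemma graph_dist_triangle x y z :
  graph_dist e x z <= graph_dist e x y + graph_dist e y z.
Proof.
case: (ltnP (graph_dist e x y) #|T|) => [|geT]; last first.
  exact: leq_trans (graph_dist_le_card x z) (leq_trans geT (leq_addr _ _)).
case: (ltnP (graph_dist e y z) #|T|) => [|geT]; last first.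
  by move=> _; exact: leq_trans (graph_dist_le_card x z) (leq_trans geT (leq_addl _ _)).
move=> /graph_dist_attained[q [yq qE <-]] /graph_dist_attained[p [xp pE <-]].
by rewrite -size_cat graph_dist_le // ?cat_path ?last_cat pE ?xp.
Qed.

Lemma graph_dist_sym x y : symmetric e -> graph_dist e x y = graph_dist e y x.
Proof.
move=> esym; suff le u v : graph_dist e u v <= graph_dist e v u.
  by apply/eqP; rewrite eqn_leq !le.
case: (ltnP (graph_dist e v u) #|T|) => [|geT]; last first.
  exact: leq_trans (graph_dist_le_card u v) geT.
move=> /graph_dist_attained[p [vp <- <-]].
(* The reversed walk starts at [last v p]; [rev (belast v p)] lists its further vertices, down to
   [v]. *)
rewrite -(size_belast v p) -size_rev; apply: graph_dist_le.
  by rewrite rev_path (eq_path (e' := e)).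
case: p {vp} => [//|w p] /=; by rewrite rev_cons last_rcons.
Qed.

End GraphDistance.

Lemma grid_edge_sym r c : symmetric (@grid_edge r c).
Proof.
move=> u v; rewrite /grid_edge /consecutive (eq_sym v.1) (eq_sym v.2).
by rewrite (orbC (v.2.+1 == _)) (orbC (v.1.+1 == _)).
Qed.

Section Assignment.

Set Implicit Arguments.
Unset Strict Implicit.
Unset Printing Implicit Defensive.

Variables (r c : nat).
Local Notation V := (gridpoint r c).
Implicit Types (s t : seq V) (x f : V).

Lemma cost_rcons s t x f :
  size s = size t -> cost (rcons s x) (rcons t f) = cost s t + grid_dist x f.
Proof. by move=> st; rewrite /cost zip_rcons // -cats1 big_cat big_seq1. Qed.

Lemma cost_le s t : size s = size t -> cost s t <= size s * #|V|.
Proof.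
elim/last_ind: s t => [|s x IH] t; first by case: t => // _; rewrite /cost big_nil.
case/lastP: t => [|t f]; rewrite !size_rcons // => -[st].
by rewrite cost_rcons // mulSn addnC leq_add ?graph_dist_le_card ?IH.
Qed.

(** Each customer and its facility differ in [phi] by at most their distance. The two halves bound
    the absolute difference of the sums without subtracting in [nat]. *)
Lemma lipschitz_cost (phi : V -> nat) s t :
    (forall u v, phi u <= grid_dist u v + phi v) -> size s = size t ->
  \sum_(u <- s) phi u <= cost s t + \sum_(v <- t) phi v /\
  \sum_(v <- t) phi v <= cost s t + \sum_(u <- s) phi u.
Proof.
move=> lip; elim/last_ind: s t => [|s x IH] t.
  by case: t => // _; rewrite !big_nil.
case/lastP: t => [|t f]; rewrite !size_rcons // => -[st].
have [le1 le2] := IH t st.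
rewrite cost_rcons // -!cats1 !big_cat !big_seq1 /=.
have := lip x f; have := lip f x.
rewrite /grid_dist (graph_dist_sym f x (@grid_edge_sym r c)).
by move: le1 le2; set a := \sum_(u <- s) _; set b := \sum_(v <- t) _; lia.
Qed.

(** Sums of [phi] over facilities depend only on the loads, so [t] and [t'] are compared through
    [t0], the algorithm's own assignment, even if all three match customers differently. *)
Lemma new_facility_dist s x f t t' t0 :
    size s = size t -> perm_eq t t0 ->
    size (rcons s x) = size t' -> perm_eq t' (rcons t0 f) ->
  grid_dist x f <= cost s t + cost (rcons s x) t'.
Proof.
move=> st tt0 st' t't0; pose phi v := @grid_dist r c v f.
have lip u v : phi u <= grid_dist u v + phi v by exact: graph_dist_triangle.
have phi_f : phi f = 0 by exact: graph_dist_self.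
have [_] := lipschitz_cost lip st; have [+ _] := lipschitz_cost lip st'.
rewrite (perm_big _ tt0) (perm_big _ t't0) -!cats1 !big_cat !big_seq1 /=.
rewrite phi_f -[grid_dist x f]/(phi x).
by set a := \sum_(v <- s) _; set b := \sum_(v <- t0) _; lia.
Qed.

Variables (F : {set V}) (l : nat).

Lemma feasible_belast s t x f :
  feasible F l (rcons s x) (rcons t f) -> feasible F l s t.
Proof.
rewrite /feasible !size_rcons eqSS all_rcons => /and3P[-> /andP[_ ->]] /=.
move=> /forall_inP load; apply/forall_inP => g /load; apply: leq_trans.
by rewrite -cats1 count_cat leq_addr.
Qed.

Lemma opt_cost_le s t : feasible F l s t -> opt_cost F l s <= cost s t.
Proof.
move=> st; have /eqP size_t : size t == size s by case/and3P: st.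
rewrite /opt_cost -minEnat -leEnat.
exact: (bigmin_inf (Tuple (introT eqP size_t))).
Qed.

Lemma opt_cost_ge s k :
    k <= size s * #|V| -> (forall t, feasible F l s t -> k <= cost s t) ->
  k <= opt_cost F l s.
Proof.
move=> k_le k_min; rewrite /opt_cost; elim/big_ind: _ => // [m n|t].
  by rewrite leq_min => -> ->.
exact: k_min.
Qed.

Lemma optimal_cost_le s t : optimal F l s t -> cost s t <= opt_cost F l s.
Proof.
move=> [/and3P[/eqP st _ _] tmin]; apply: opt_cost_ge => //.
exact/cost_le/esym.
Qed.

Lemma opt_cost_rcons s x : opt_cost F l s <= opt_cost F l (rcons s x).
Proof.
apply: opt_cost_ge => [|t].
  (* The default value also grows with the input, which covers a longer input without feasible
     assignments. *)
  rewrite size_rcons mulSn /opt_cost -minEnat -leEnat.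
  exact/(le_trans (bigmin_le_id _ _ _ _))/leq_addl.
(* Dropping the last customer keeps an assignment feasible and does not raise its cost. *)
case/lastP: t => [|t f] st; first by case/and3P: st; rewrite size_rcons.
have st' := feasible_belast st; have /and3P[/eqP size_t _ _] := st'.
rewrite cost_rcons //; exact: leq_trans (opt_cost_le st') (leq_addr _ _).
Qed.

Variable alg : seq V -> V.

Lemma run_rcons s x : run alg (rcons s x) = rcons (run alg s) (alg (rcons s x)).
Proof.
rewrite /run size_rcons -addn1 iotaD map_cat add0n /= cats1; congr rcons.
  apply/eq_in_map => i; rewrite mem_iota add0n => /= lt_is.
  by rewrite -cats1 takel_cat.
by rewrite take_oversize // size_rcons.
Qed.

Lemma size_run s : size (run alg s) = size s.
Proof. by rewrite size_map size_iota. Qed.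

Hypothesis fill : optimal_fill F l alg.

Lemma optimal_fill_loads s : valid_input F l s ->
  exists2 t, optimal F l s t & perm_eq t (run alg s).
Proof.
case/lastP: s => [_|s x /fill[t t_opt]]; last by rewrite -run_rcons; exists t.
exists [::] => //; split=> [|t _]; last by rewrite /cost big_nil.
by rewrite /feasible /=; apply/forall_inP.
Qed.

Lemma optimal_fill_cost s : valid_input F l s ->
  alg_cost alg s <= 2 * size s * opt_cost F l s.
Proof.
elim/last_ind: s => [|s x IH] valid; first by rewrite /alg_cost /cost big_nil.
have valid_s : valid_input F l s.
  by move: valid; rewrite /valid_input size_rcons; exact: ltnW.
have [t t_opt tE] := optimal_fill_loads valid_s.
have [t' t'_opt t'E] := fill valid.
have size_t : size s = size t by case: t_opt => /and3P[/eqP].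
have size_t' : size (rcons s x) = size t' by case: t'_opt => /and3P[/eqP].
have := new_facility_dist size_t tE size_t' t'E.
have := optimal_cost_le t_opt; have := optimal_cost_le t'_opt.
have := opt_cost_rcons s x; have := IH valid_s.
(* With [n = size s] and optima [a <= b] before and after [x], this is [2na + a + b <= 2(n+1)b]. *)
rewrite /alg_cost run_rcons cost_rcons ?size_run // size_rcons; nia.
Qed.

Lemma valid_input_size s : valid_input F l s -> size s <= l * (r * c).
Proof.
have card_V : #|V| = r * c by rewrite card_prod !card_ord.
by move=> /leq_trans; apply; rewrite mulnC -card_V leq_mul2l max_card orbT.
Qed.

End Assignment.

Local Open Scope ring_scope.

Theorem theorem2 (R : realType) (l : nat) (l_gt0 : (0 < l)%N) :
  exists C alpha : R,
  forall (r c : nat) (F : {set gridpoint r c})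
         (alg : seq (gridpoint r c) -> gridpoint r c),
    optimal_fill F l alg ->
    (competitive_ratio F l alpha alg <= (C * (r * c)%N%:R)%:E)%E.
Proof.
(* The factor [2n] is at most [2l] times [r * c], and the bound holds on each input with no additive
   term. *)
exists (2 * l)%:R, 0 => r c F alg fill.
apply: ereal_inf_lbound; exists ((2 * l)%:R * (r * c)%N%:R) => //.
split=> [|s valid]; first by rewrite mulr_ge0 ?ler0n.
rewrite addr0 -!natrM ler_nat.
apply: leq_trans (optimal_fill_cost fill valid) _.
by rewrite leq_mul2r -mulnA leq_mul2l (valid_input_size valid) !orbT.
Qed.
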